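(* Let $A_1,\dots,A_c\in\mathbb{C}^{n\times n}$ be Hermitian. Then the additive characteristic polynomial $\alpha(A_1,\dots,A_c;x)$ is real-rooted.
   Context: A cycle on $[n]$ is a closed walk $v_0v_1\cdots v_t=v_0$ of length $t\ge1$ in which $v_0,\dots,v_{t-1}$ are distinct, considered as a set of arcs $(v_i,v_{i+1})$, with starting point forgotten (self-loops are cycles of length 1, and $i\to j\to i$ with $i\ne j$ is a cycle of length 2). A colored cycle is a pair $\tilde\gamma=(\gamma,j)$ with $\gamma$ a cycle on $[n]$ and $j\in[c]$; its weight is $w(\tilde\gamma)=\prod_{(a,b)\in\gamma}(A_j)_{ab}$ and its length is $\ell(\tilde\gamma)=\ell(\gamma)$. A trivial heap $M$ is a (possibly empty) set of pairwise vertex-disjoint colored cycles of nonzero weight; $\ell(M)=\sum_{\tilde\gamma\in M}\ell(\tilde\gamma)$, $w(M)=\prod_{\tilde\gamma\in M}w(\tilde\gamma)$, and $|M|$ is the number of colored cycles in it. The additive characteristic polynomial is $$\alpha(A_1,\dots,A_c;x)=\sum_{k=0}^n b_kx^{n-k},\qquad b_k=\sum_{M:\ \ell(M)=k}(-1)^{|M|}w(M).$$ *)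

(* Defs.v *)
From mathcomp Require Import all_boot all_order all_algebra.
From mathcomp Require Import complex.
From mathcomp Require Import reals.

Set Implicit Arguments.
Unset Strict Implicit.
Unset Printing Implicit Defensive.

Import Order.TTheory GRing.Theory Num.Theory.
Local Open Scope ring_scope.

Section Cycles.
Variable n : nat.

(* [ordS] is the cyclic successor on 'I_t.+1, so the last arc returns to
   [v ord0]. *)
Definition closed_walk_arcs (t : nat) (v : 'I_t.+1 -> 'I_n) :
    {set 'I_n * 'I_n} :=
  [set (v i, v (ordS i)) | i : 'I_t.+1].

(* The length is t.+1 with t : 'I_n. This is no restriction, since distinct
   vertices force the length to be at most n; see [is_cycleP]. *)
Definition is_cycle (g : {set 'I_n * 'I_n}) : bool :=
  [exists t : 'I_n, [exists v : {ffun 'I_t.+1 -> 'I_n},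
    injectiveb v && (g == closed_walk_arcs v)]].

Lemma is_cycleP (g : {set 'I_n * 'I_n}) :
  reflect (exists t (v : 'I_t.+1 -> 'I_n),
             injective v /\ g = closed_walk_arcs v)
          (is_cycle g).
Proof.
apply: (iffP existsP) => [[t /existsP[v /andP[/injectiveP vI /eqP ->]]]|].
  by exists t, v.
move=> [t [v [vI ->]]].
have tn : (t < n)%N by have := leq_card v vI; rewrite !card_ord.
exists (Ordinal tn); apply/existsP; exists (finfun v : {ffun 'I_t.+1 -> 'I_n}).
apply/andP; split.
  by apply/injectiveP => i j; rewrite !ffunE => /vI.
by apply/eqP/eq_imset => i; rewrite !ffunE.
Qed.

(* The length of a cycle is its number of arcs. *)
Lemma card_closed_walk_arcs (t : nat) (v : 'I_t.+1 -> 'I_n) :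
  injective v -> #|closed_walk_arcs v| = t.+1.
Proof. by move=> vI; rewrite card_imset ?card_ord // => i j [/vI]. Qed.

Definition cycle_vertices (g : {set 'I_n * 'I_n}) : {set 'I_n} :=
  [set a.1 | a in g].

End Cycles.

Section Heaps.
Variables (C : numClosedFieldType) (n c : nat) (A : 'I_c -> 'M[C]_n).

(* A pair (arc set, color); it is a colored cycle when the arc set satisfies
   [is_cycle]. *)
Local Notation colored_arcs := ({set 'I_n * 'I_n} * 'I_c)%type.

Definition cycle_weight (g : colored_arcs) : C :=
  \prod_(a in g.1) A g.2 a.1 a.2.

Definition cycle_length (g : colored_arcs) : nat := #|g.1|.

Definition trivial_heap (M : {set colored_arcs}) : bool :=
  [forall g in M, is_cycle g.1 && (cycle_weight g != 0)] &&
  [forall g in M, forall h in M,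
     (g != h) ==> [disjoint cycle_vertices g.1 & cycle_vertices h.1]].

Definition heap_length (M : {set colored_arcs}) : nat :=
  (\sum_(g in M) cycle_length g)%N.

Definition heap_weight (M : {set colored_arcs}) : C :=
  \prod_(g in M) cycle_weight g.

Definition additive_coef (k : nat) : C :=
  \sum_(M : {set colored_arcs} | trivial_heap M && (heap_length M == k))
    (-1) ^+ #|M| * heap_weight M.

Definition additive_char_poly : {poly C} :=
  \sum_(k < n.+1) additive_coef k *: 'X^(n - k).

End Heaps.

Definition real_rooted (C : numClosedFieldType) (p : {poly C}) : Prop :=
  forall z : C, root p z -> z \is Num.real.

(* Main.v *)
Require Import Defs.
From mathcomp Require Import all_boot all_order all_algebra all_fingroup.
From mathcomp Require Import complex.
From mathcomp Require Import reals.
From mathcomp Require Import ring.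

(** The idea is that real-rootedness follows from the stability (absence of
zeros in a half-plane) of a polynomial with one variable per vertex.

Grouping the cycles of a heap by color and applying the Leibniz expansion to
each color ([minorN_packings]) gives
  alpha(z) = sum over pairwise disjoint S_1, ..., S_c of
             z ^ (n - |S_1| - ... - |S_c|) * prod_j det (- A_j[S_j]).
Without the disjointness condition, and with one variable z_k per vertex k, the
analogous sum, where z_k has exponent c minus the number of S_j containing k, is
the product over j of det (Z - A_j), with Z the diagonal matrix of the z_k. This
product has no zero when all z_k lie in a common open half-plane bounded by the
real line, since the A_j are Hermitian ([hermitian_det_neq0]). So it remains to
see that discarding the families in which some vertex lies in two of the sets
creates no zero in the half-plane.

This is done one vertex at a time ([stable_truncate]). As a polynomial in z_k
alone, the sum is q_0 z_k ^ D + q_1 z_k ^ (D - 1) + ..., and discarding the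
families with k in two of the sets leaves q_0 z_k + q_1. Its zero is the sum of
the roots of the former polynomial, all of which lie in the closed complementary
half-plane, a set closed under addition. That q_0 does not vanish is part of the
induction hypothesis: q_0 is the same kind of sum over the vertices other
than k. *)

Import Order.TTheory GRing.Theory Num.Theory.
Local Open Scope ring_scope.

Set Implicit Arguments.
Unset Strict Implicit.
Unset Printing Implicit Defensive.

(** * Half-planes and truncation *)

Section Stability.
Variables (C : numClosedFieldType) (s : C).
Hypothesis s_real : s \is Num.real.

(** The sign of [s] selects the upper or the lower half-plane, so that one
argument excludes roots from both. *)
Definition half_plane (w : C) : bool := 0 < s * 'Im w.

Lemma half_planeN w : ~~ half_plane w = (s * 'Im w <= 0).
Proof. by rewrite -real_leNgt ?real0 ?realM ?Creal_Im. Qed.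

Lemma half_plane_neq0 w : half_plane w -> w != 0.
Proof. by apply: contraTneq => ->; rewrite half_planeN raddf0 mulr0. Qed.

Lemma half_planeN_sum (r : seq C) :
  all (fun w => ~~ half_plane w) r -> ~~ half_plane (\sum_(w <- r) w).
Proof.
rewrite half_planeN raddf_sum mulr_sumr => /allP r_out.
by rewrite big_seq sumr_le0 // => w /r_out; rewrite half_planeN.
Qed.

(** By Vieta, a zero of [q`_D * 'X + q`_D.-1] is the sum of the roots of [q];
these all lie in the complement of the half-plane, which is closed under
addition. *)
Lemma half_plane_lead_neq0 (q : {poly C}) (D : nat) (z : C) :
    (0 < D)%N -> (size q <= D.+1)%N -> q`_D != 0 ->
    (forall t, half_plane t -> q.[t] != 0) -> half_plane z ->
  q`_D * z + q`_D.-1 != 0.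
Proof.
move=> D_gt0 size_q qD q_stable z_in.
have [rs def_q] := closed_field_poly_normal q.
have size_qD : size q = D.+1.
  apply/eqP; rewrite eqn_leq size_q ltnNge.
  by apply: contra qD => /(nth_default 0) ->.
have lead_q : lead_coef q = q`_D by rewrite lead_coefE size_qD.
have size_rs : size rs = D.
  by apply: succn_inj; rewrite -size_qD {1}def_q lead_q size_scale // size_prod_XsubC.
have def_qD1 : q`_D.-1 = - (q`_D * \sum_(w <- rs) w).
  rewrite {1}def_q coefZ lead_q -[in D.-1]size_rs coefPn_prod_XsubC ?mulrN //.
  by rewrite size_rs -lt0n.
rewrite def_qD1 -mulrBr mulf_neq0 //.
apply: contraTneq z_in => /(canRL (subrK _)) ->; rewrite add0r.
apply: half_planeN_sum; apply/allP => w w_rs.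
apply: contraTN isT => /q_stable.
rewrite def_q hornerZ horner_prod (big_rem w) //=.
by rewrite hornerXsubC subrr mul0r mulr0 eqxx.
Qed.

Section Truncation.
Variables (I X : finType) (F : X -> C) (m : X -> I -> nat).

(** In the variables [1 / z k], and up to the monomial with exponents [d], this
is the generating polynomial of [F] with every monomial of degree more than
[d k] in some variable [k] deleted. A value [d k = 0] thus sets the variable
[1 / z k] to zero. *)
Definition truncation (d : I -> nat) (z : I -> C) : C :=
  \sum_(x | [forall k, m x k <= d k]%N) F x * \prod_k z k ^+ (d k - m x k).

Definition stable (d : I -> nat) : Prop :=
  forall z, (forall k, half_plane (z k)) -> truncation d z != 0.

Lemma truncation_ext d d' z z' :
  d =1 d' -> z =1 z' -> truncation d z = truncation d' z'.
Proof.
move=> eq_d eq_z; apply: eq_big => [x|x _].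
  by apply: eq_forallb => k; rewrite eq_d.
by congr (_ * _); apply: eq_bigr => k _; rewrite eq_d eq_z.
Qed.

(** Isolates the variable [k], so that the sums for different values of [d k]
range over the same index set. *)
Lemma truncationE (k : I) (d : I -> nat) (z : I -> C) :
  truncation d z = \sum_(x | [forall i, (i != k) ==> (m x i <= d i)%N])
   if (m x k <= d k)%N then
     (F x * \prod_(i | i != k) z i ^+ (d i - m x i)) * z k ^+ (d k - m x k)
   else 0.
Proof.
rewrite /truncation -big_mkcondr /=; apply: eq_big => [x|x _].
  apply/forallP/andP => [le_m|[/forallP le_m le_mk] i].
    by split=> //; apply/forallP => i; rewrite le_m implybT.
  by have := le_m i; case: eqP => [->|].
by rewrite (bigD1 k) //= mulrCA mulrC.
Qed.

(** As a polynomial in [z k], the truncation at [D] has the truncation at [0] as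
leading coefficient, and the truncation at [1] is made of its two leading
coefficients. *)
Lemma stable_truncate (d : I -> nat) (k : I) (D : nat) : (0 < D)%N ->
  stable [eta d with k |-> 0] -> stable [eta d with k |-> D] ->
  stable [eta d with k |-> 1].
Proof.
move=> D_gt0 stable0 stableD z z_in.
pose c x := F x * \prod_(i | i != k) z i ^+ (d i - m x i).
pose P x := [forall i, (i != k) ==> (m x i <= d i)%N].
have truncE e t : truncation [eta d with k |-> e] [eta z with k |-> t]
    = \sum_(x | P x) if (m x k <= e)%N then c x * t ^+ (e - m x k) else 0.
  rewrite (truncationE k) /= eqxx; apply: eq_big => [x|x _].
    by apply: eq_forallb => i /=; case: (i == k).
  case: ifP => // _; congr (_ * _ * _).
  by apply: eq_bigr => i /negPf /= ->.
have zE : [eta z with k |-> z k] =1 z by move=> i /=; case: eqP => // ->.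
pose q : {poly C} :=
  \sum_(x | P x) if (m x k <= D)%N then c x *: 'X^(D - m x k) else 0.
have q_coef i : (i <= D)%N -> q`_(D - i) = \sum_(x | P x) if m x k == i then c x else 0.
  move=> le_iD; rewrite coef_sum; apply: eq_bigr => x _.
  case: (leqP (m x k) D) => [le_mD|lt_Dm].
    rewrite coefZ coefXn; rewrite eqn_sub2lE // eq_sym.
    by case: eqP => _; rewrite ?mulr1 ?mulr0.
  by rewrite coef0; case: eqP => // eq_mi; rewrite eq_mi ltnNge le_iD in lt_Dm.
have qD : q`_D = truncation [eta d with k |-> 0] [eta z with k |-> z k].
  rewrite truncE -[D]subn0 q_coef //; apply: eq_bigr => x _.
  by rewrite leqn0; case: eqP => // ->; rewrite expr0 mulr1.
rewrite -(truncation_ext (frefl _) zE) truncE.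
have -> : \sum_(x | P x) (if (m x k <= 1)%N then c x * z k ^+ (1 - m x k) else 0)
    = q`_D * z k + q`_D.-1.
  rewrite -subn1 q_coef // -[D in q`_D]subn0 q_coef // mulr_suml -big_split /=.
  apply: eq_bigr => x _; case: (m x k) => [|[|e]] /=.
  - by rewrite expr1 addr0.
  - by rewrite mulr1 mul0r add0r.
  - by rewrite mul0r addr0.
apply: half_plane_lead_neq0 => //.
- apply: (leq_trans (size_sum _ _ _)); apply/bigmax_leqP => x _.
  case: ifP => _; last by rewrite size_poly0.
  by rewrite (leq_trans (size_scale_leq _ _)) // size_polyXn ltnS leq_subr.
- by rewrite qD (truncation_ext (frefl _) zE) stable0.
- move=> t t_in.
  suff -> : q.[t] = truncation [eta d with k |-> D] [eta z with k |-> t].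
    by apply: stableD => i /=; case: ifP.
  rewrite truncE horner_sum; apply: eq_bigr => x _.
  by case: ifP; rewrite ?horner0 // hornerZ hornerXn.
Qed.

Lemma stable_ext d d' : d =1 d' -> stable d -> stable d'.
Proof.
by move=> eq_d st z /st; rewrite (truncation_ext eq_d (frefl z)).
Qed.

(** Truncation is applied to one variable after another; allowing any exponent
to be [0] keeps the family of exponents closed under the hypotheses of
[stable_truncate]. *)
Lemma stable_truncate_all (D : nat) : (0 < D)%N ->
    (forall T : {set I}, stable (fun k => if k \in T then D else 0)%N) ->
  stable (fun=> 1%N).
Proof.
move=> D_gt0 base.
suff stableK r (T : {set I}) : uniq r ->
    stable (fun k => if k \in r then 1 else if k \in T then D else 0)%N.
  by apply: stable_ext (stableK _ set0 (enum_uniq I)) => k; rewrite mem_enum.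
elim: r T => [|k r IHr] T /=; first by move=> _; apply: stable_ext (base T).
case/andP=> kr /IHr {}IHr.
have [] := (IHr (T :\ k), IHr (k |: T)) => stable0 stableD.
pose d i := (if i \in r then 1 else if i \in T then D else 0)%N.
apply: (@stable_ext [eta d with k |-> 1%N]) => [i /=|].
  by rewrite inE /d; case: eqP.
apply: (stable_truncate D_gt0).
  apply: stable_ext stable0 => i /=; rewrite /d !inE.
  by case: eqP => // ->; rewrite (negPf kr).
apply: stable_ext stableD => i /=; rewrite /d !inE.
by case: eqP => // ->; rewrite (negPf kr).
Qed.
End Truncation.
End Stability.

(** * Principal minors of Hermitian matrices *)

Section Minors.
Variables (R : comNzRingType) (n : nat).
Implicit Types (A : 'M[R]_n) (S T : {set 'I_n}).

(** The principal minor of [- A] on [S]; the identity rows outside [S] spare a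
change of dimension. *)
Definition minorN A S : R :=
  \det (\matrix_(i, j) (if i \in S then - A i j else (i == j)%:R)).

(** [Z - A], compressed to [T], where [Z] is diagonal with entries [z]. *)
Definition pencil A T (z : 'I_n -> R) : 'M[R]_n :=
  \matrix_(i, j) (if i \in T then (i == j)%:R * z i - A i j else (i == j)%:R).

Lemma sum_minorN A T (z : 'I_n -> R) :
  \sum_(S : {set 'I_n} | S \subset T) minorN A S * \prod_(i in T :\: S) z i
  = \det (pencil A T z).
Proof.
pose zT i := if i \in T then z i else 1.
under eq_bigr do rewrite mulr_suml.
rewrite exchange_big /=; apply: eq_bigr => p _.
under eq_bigr do rewrite -mulrA.
rewrite -mulr_sumr; congr (_ * _).
pose F i := if i \in T then - A i (p i) else 0.
pose G i := (i == p i)%:R * zT i.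
transitivity (\prod_i (F i + G i)); last first.
  apply: eq_bigr => i _; rewrite mxE /F /G /zT.
  by case: ifP => _; rewrite ?add0r ?mulr1 // addrC.
rewrite bigA_distr big_mkcond /=; apply: eq_bigr => S _.
have [sST|/subsetPn[i iS iT]] := boolP (S \subset T); last first.
  by rewrite (bigD1 i) //= iS /F (negPf iT) mul0r.
rewrite (big_mkcond (fun i => i \in T :\: S)) -big_split /=.
apply: eq_bigr => i _; rewrite mxE inE /F /G /zT.
case: (boolP (i \in S)) => [iS|_] /=; last by case: ifP.
by rewrite (subsetP sST) // mulr1.
Qed.
End Minors.

(** The exponent of [1 / z k] carried by a family of vertex sets, one per color,
in the product over the colors of the generating polynomials of the minors. *)
Definition colors_at n c (S : {ffun 'I_c -> {set 'I_n}}) (k : 'I_n) : nat :=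
  #|[pred j | k \in S j]|.

Section Hermitian.
Variables (C : numClosedFieldType) (s : C).
Hypothesis s_real : s \is Num.real.

Lemma hermitian_form_real n (A : 'M[C]_n) (u : 'I_n -> C) :
  A \is hermsymmx -> \sum_i \sum_j u i * A j i * (u j)^* \is Num.real.
Proof.
move=> /is_hermitianmxP; rewrite expr0 scale1r => hA.
have A_conj i j : (A i j)^* = A j i by rewrite [in RHS]hA !mxE.
rewrite CrealE rmorph_sum; apply/eqP => /=.
under eq_bigr do rewrite rmorph_sum.
rewrite exchange_big; apply: eq_bigr => i _; apply: eq_bigr => j _ /=.
by rewrite !rmorphM /= conjCK A_conj mulrC [X in _ * X]mulrC mulrA.
Qed.

(** A vector [u] in the kernel is supported on [T], and the sum of the
[z i * `|u i| ^+ 2] equals a value of the Hermitian form of [A], which is real;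
as all [z i] are in the half-plane, [u] vanishes. *)
Lemma hermitian_det_neq0 n (A : 'M[C]_n) (T : {set 'I_n}) (z : 'I_n -> C) :
    A \is hermsymmx -> (forall i, half_plane s (z i)) ->
  \det (pencil A T z) != 0.
Proof.
move=> hA z_in; rewrite -det_tr; apply/det0P => -[u u_neq0 uM0].
have row_eq j : \sum_i u 0 i * (if j \in T then (j == i)%:R * z j - A j i
                        else (j == i)%:R) = 0.
  transitivity ((u *m (pencil A T z)^T) 0 j).
    by rewrite mxE; apply: eq_bigr => i _; rewrite !mxE.
  by rewrite uM0 mxE.
have delta (a : C) j : \sum_i u 0 i * ((j == i)%:R * a) = u 0 j * a.
  rewrite (bigD1 j) //= eqxx mul1r big1 ?addr0 // => i.
  by rewrite eq_sym => /negPf ->; rewrite mul0r mulr0.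
have u_out j : j \notin T -> u 0 j = 0.
  move=> /negPf jT; have := row_eq j; rewrite jT.
  by under eq_bigr do rewrite -[_%:R]mulr1; rewrite delta mulr1.
have u_in j : u 0 j * z j * (u 0 j)^* = \sum_i u 0 i * A j i * (u 0 j)^*.
  have [jT|/u_out ->] := boolP (j \in T); last first.
    by rewrite conjC0 mulr0 big1 // => i _; rewrite mulr0.
  rewrite -mulr_suml; congr (_ * _); apply/eqP; rewrite -subr_eq0 -delta -sumrB.
  by apply/eqP; rewrite -[RHS](row_eq j) jT; apply: eq_bigr => i _; rewrite mulrBr.
have form_real := hermitian_form_real (u 0) hA.
have: s * 'Im (\sum_j u 0 j * z j * (u 0 j)^*) = 0.
  under eq_bigr do rewrite u_in.
  by rewrite exchange_big /= (Creal_ImP _ form_real) mulr0.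
have norm_term j : s * 'Im (u 0 j * z j * (u 0 j)^*) = s * 'Im (z j) * `|u 0 j| ^+ 2.
  rewrite mulrAC -normCK ImMl; first by rewrite [_ ^+ 2 * _]mulrC mulrA.
  by rewrite realX ?normr_real.
rewrite raddf_sum mulr_sumr => /eqP; rewrite psumr_eq0 => [/allP u0|j _]; last first.
  by rewrite /= norm_term mulr_ge0 ?exprn_ge0 // ltW //; apply: z_in.
case/negP: u_neq0; apply/eqP/rowP => j; rewrite mxE.
have := u0 j (mem_index_enum _).
by rewrite /= norm_term mulf_eq0 (gt_eqF (z_in j)) expf_eq0 normr_eq0 => /eqP.
Qed.

(** Here nothing is truncated on [T], because a vertex receives at most [c]
colors: the polynomial is a product of determinants of pencils. The exponent is
[c.+1] rather than [c] so that it is positive even when [c] is zero; the extra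
factors [z k] do not vanish on the half-plane. *)
Lemma stable_minors n c (A : 'I_c -> 'M[C]_n) (T : {set 'I_n}) :
    (forall j, A j \is hermsymmx) ->
  stable s (fun S : {ffun 'I_c -> {set 'I_n}} => \prod_j minorN (A j) (S j))
    (@colors_at n c) (fun k => if k \in T then c.+1 else 0)%N.
Proof.
move=> hA z z_in.
set t := truncation _ _ _ _.
suff -> : t = (\prod_(k in T) z k) * 
    \prod_j \sum_(S : {set 'I_n} | S \subset T)
      minorN (A j) S * \prod_(i in T :\: S) z i.
  apply: mulf_neq0; apply/prodf_neq0 => k _; last first.
    by rewrite sum_minorN hermitian_det_neq0.
  exact: half_plane_neq0 (z_in k).
rewrite bigA_distr_big mulr_sumr; apply: eq_big => [S|S S_le].
  apply/forallP/ffun_onP => [S_le j|S_le k].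
    apply/subsetP => k kS; have := S_le k; case: ifP => // _.
    by rewrite leqn0 => /eqP/card0_eq/(_ j); rewrite inE kS.
  case: ifPn => [_|kT].
    by rewrite (leq_trans (max_card _)) ?card_ord.
  rewrite leqn0; apply/eqP/eq_card0 => j; rewrite inE.
  by apply: contraNF kT; apply/subsetP: k; apply: S_le.
rewrite big_split /= mulrCA; congr (_ * _).
rewrite (exchange_big_dep (mem T)) /= => [|j k _]; last first.
  by rewrite inE => /andP[].
rewrite -big_split [RHS]big_mkcond /=; apply: eq_bigr => k _.
case: ifP => kT; last by rewrite expr0.
rewrite prodr_const -exprS; congr (_ ^+ _).
rewrite -[c in c.+1]card_ord -(cardC [pred j | k \in S j]) subSn ?leq_addr // addKn.
congr _.+1; apply: eq_card => j; rewrite !inE.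
by rewrite -[RHS]/(k \in T :\: S j) inE kT andbT.
Qed.
End Hermitian.

(** * Disjoint cycles and permutations *)

Section CyclePackings.
Variable n : nat.
Implicit Types (g h : {set 'I_n * 'I_n}) (N : {set {set 'I_n * 'I_n}}).
Implicit Types (p : {perm 'I_n}) (O S : {set 'I_n}).

Definition cycle_packing N : bool :=
  [forall g in N, is_cycle g] &&
  [forall g in N, forall h in N,
     (g != h) ==> [disjoint cycle_vertices g & cycle_vertices h]].

Definition packing_vertices N : {set 'I_n} := \bigcup_(g in N) cycle_vertices g.

Lemma mem_cycle_vertices g i j : (i, j) \in g -> i \in cycle_vertices g.
Proof. by move=> gij; apply/imsetP; exists (i, j). Qed.

Lemma cycle_verticesP g i :
  reflect (exists j, (i, j) \in g) (i \in cycle_vertices g).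
Proof.
apply: (iffP imsetP) => [[[a b] ab_g ->]|[j ij_g]]; first by exists b.
by exists (i, j).
Qed.

Lemma cycle_functional g i j j' :
  is_cycle g -> (i, j) \in g -> (i, j') \in g -> j = j'.
Proof.
case/is_cycleP=> t [v [v_inj ->]] /imsetP[k _ [-> ->]].
by case/imsetP=> k' _ [/v_inj -> ->].
Qed.

Lemma cycle_injective g i i' j :
  is_cycle g -> (i, j) \in g -> (i', j) \in g -> i = i'.
Proof.
case/is_cycleP=> t [v [v_inj ->]] /imsetP[k _ [-> ->]] /imsetP[k' _ [->]].
by move/v_inj/ordS_inj ->.
Qed.

Lemma cycle_target g i j : is_cycle g -> (i, j) \in g -> j \in cycle_vertices g.
Proof.
case/is_cycleP=> t [v [v_inj ->]] /imsetP[k _ [_ ->]].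
by apply: (@mem_cycle_vertices _ _ (v (ordS (ordS k)))); apply: imset_f.
Qed.

Lemma cycle_vertices_neq0 g : is_cycle g -> exists i, i \in cycle_vertices g.
Proof.
case/is_cycleP=> t [v [_ ->]]; exists (v ord0).
by apply: (@mem_cycle_vertices _ _ (v (ordS ord0))); apply: imset_f.
Qed.

Lemma packing_eq N g h i : cycle_packing N -> g \in N -> h \in N ->
  i \in cycle_vertices g -> i \in cycle_vertices h -> g = h.
Proof.
case/andP=> _ /forall_inP disjN gN hN ig ih.
apply/eqP/idPn => gh; have /forall_inP/(_ h hN)/implyP/(_ gh) := disjN g gN.
by move/disjointFr/(_ ig); rewrite ih.
Qed.

Definition perm_arcs p O : {set 'I_n * 'I_n} := [set (i, p i) | i in O].

Lemma mem_perm_arcs p O i j :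
  ((i, j) \in perm_arcs p O) = (i \in O) && (p i == j).
Proof.
apply/imsetP/andP => [[k kO [-> ->]]|[iO /eqP <-]]; first by rewrite eqxx.
by exists i.
Qed.

Lemma perm_arcs_vertices p O : cycle_vertices (perm_arcs p O) = O.
Proof.
apply/setP => i; apply/cycle_verticesP/idP => [[j]|iO].
  by rewrite mem_perm_arcs => /andP[].
by exists (p i); rewrite mem_perm_arcs iO eqxx.
Qed.

Lemma perm_arcs_inj p : injective (perm_arcs p).
Proof.
by move=> O O' eqO; rewrite -(perm_arcs_vertices p O) eqO perm_arcs_vertices.
Qed.

Lemma is_cycle_porbit p i : is_cycle (perm_arcs p (porbit p i)).
Proof.
have [t card_orb] : exists t, #|porbit p i| = t.+1.
  by exists #|porbit p i|.-1; rewrite prednK // lt0n card_porbit_neq0.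
pose v (k : 'I_t.+1) := iter k p i.
have v_ordS k : v (ordS k) = p (v k).
  rewrite /v /= -iterS; have [->|k_lt] := eqVneq (k : nat) t.
    by rewrite modnn -card_orb iter_porbit.
  by rewrite modn_small // ltnS ltn_neqAle k_lt leq_ord.
apply/is_cycleP; exists t, v; split.
  move=> k k' eq_v; apply/ord_inj/eqP.
  rewrite -(@nth_uniq _ i (traject p i t.+1)) ?size_traject //.
    by rewrite !nth_traject //; apply/eqP.
  by rewrite -card_orb uniq_traject_porbit.
apply/setP => -[a b]; rewrite mem_perm_arcs porbit_traject card_orb.
apply/andP/imsetP => [[/trajectP[k k_lt ->] /eqP <-]|[k _ [-> ->]]].
  by exists (Ordinal k_lt); rewrite // v_ordS.
by rewrite v_ordS; split=> //; apply/trajectP; exists k.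
Qed.

(** A cycle is determined by any one of its vertices and a permutation that
follows its arcs. *)
Lemma cycle_porbit g p i : is_cycle g ->
    (forall j, j \in cycle_vertices g -> (j, p j) \in g) ->
    i \in cycle_vertices g ->
  g = perm_arcs p (porbit p i).
Proof.
move=> g_cyc g_p ig; have [t [v [v_inj def_g]]] := is_cycleP _ g_cyc.
have v_arc k : (v k, v (ordS k)) \in g by rewrite def_g; apply: imset_f.
have pv k : p (v k) = v (ordS k).
  apply: (cycle_functional g_cyc (g_p _ _) (v_arc k)).
  exact: mem_cycle_vertices (v_arc k).
have iter_v m : iter m p (v ord0) = v (inord (m %% t.+1)).
  elim: m => [|m IHm]; first by congr v; apply/val_inj; rewrite /= inordK ?mod0n.
  rewrite iterS IHm pv; congr v; apply/val_inj => /=.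
  by rewrite !inordK ?ltn_pmod // -addn1 modnDml addn1.
have orb0 : porbit p (v ord0) = cycle_vertices g.
  apply/setP => j; apply/porbitP/idP => [[m ->]|/cycle_verticesP[j']].
    by rewrite permX iter_v; apply: mem_cycle_vertices (v_arc _).
  rewrite def_g => /imsetP[k _ [-> _]]; exists k.
  by rewrite permX iter_v modn_small // inord_val.
have -> : porbit p i = cycle_vertices g.
  by rewrite -orb0; apply/eqP; rewrite eq_porbit_mem orb0.
apply/setP => -[a b]; rewrite mem_perm_arcs.
apply/idP/andP => [gab|[/g_p gpa /eqP <-] //].
have ag := mem_cycle_vertices gab; split=> //.
by rewrite (cycle_functional g_cyc gab (g_p _ ag)).
Qed.

Definition perm_cycles S p : {set {set 'I_n * 'I_n}} :=
  [set perm_arcs p O | O in porbit p @: S].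

Lemma porbit_sub S p i : perm_on S p -> i \in S -> porbit p i \subset S.
Proof.
move=> pS iS; apply/subsetP => _ /porbitP[m ->]; rewrite permX.
by elim: m => //= m IHm; rewrite (perm_closed _ pS).
Qed.

Lemma perm_cycles_packing S p : cycle_packing (perm_cycles S p).
Proof.
apply/andP; split; apply/forall_inP => _ /imsetP[_ /imsetP[i iS ->] ->].
  exact: is_cycle_porbit.
apply/forall_inP => _ /imsetP[_ /imsetP[j jS ->] ->]; apply/implyP.
apply: contraR; rewrite !perm_arcs_vertices => /pred0Pn[k /andP[/= ki kj]].
apply/eqP; congr perm_arcs; move: ki kj; rewrite -!eq_porbit_mem.
by move=> /eqP <- /eqP <-.
Qed.

Lemma perm_cycles_vertices S p :
  perm_on S p -> packing_vertices (perm_cycles S p) = S.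
Proof.
move=> pS; apply/setP => i.
apply/bigcupP/idP => [[_ /imsetP[_ /imsetP[j jS ->] ->]]|iS].
  by rewrite perm_arcs_vertices; apply/subsetP/porbit_sub.
exists (perm_arcs p (porbit p i)); first by rewrite !imset_f.
by rewrite perm_arcs_vertices porbit_id.
Qed.

Lemma perm_cycles_inj S : {in perm_on S &, injective (perm_cycles S)}.
Proof.
move=> p q pS qS eq_pq; apply/permP => i.
have [iS|iS] := boolP (i \in S); last by rewrite (out_perm pS) ?(out_perm qS).
have : perm_arcs p (porbit p i) \in perm_cycles S q by rewrite -eq_pq !imset_f.
case/imsetP=> _ /imsetP[j _ ->] /setP/(_ (i, p i)).
by rewrite !mem_perm_arcs porbit_id eqxx => /esym/andP[_ /eqP].
Qed.

(** Each vertex of a packing has exactly one outgoing and one incoming arc, so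
sending a vertex along its arc, and fixing all others, is a permutation. *)
Lemma perm_cycles_surj N : cycle_packing N ->
  exists2 p, perm_on (packing_vertices N) p & perm_cycles (packing_vertices N) p = N.
Proof.
move=> packN; have cycN g : g \in N -> is_cycle g.
  by case/andP: packN => /forall_inP cycN _ /cycN.
pose f i := if [pick j | [exists g in N, (i, j) \in g]] is Some j then j else i.
have fP g i : g \in N -> i \in cycle_vertices g -> (i, f i) \in g.
  move=> gN ig; rewrite /f; case: pickP => [j /exists_inP[h hN ijh]|none].
    by rewrite (packing_eq packN gN hN ig) // (mem_cycle_vertices ijh).
  case/cycle_verticesP: ig => j ijg.
  by have /exists_inP[] := none j; exists g.
have f_out i : i \notin packing_vertices N -> f i = i.
  move=> iN; rewrite /f; case: pickP => // j /exists_inP[h hN ijh].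
  by case/bigcupP: iN; exists h => //; apply: mem_cycle_vertices ijh.
have f_in i : i \in packing_vertices N -> f i \in packing_vertices N.
  case/bigcupP=> g gN ig; apply/bigcupP; exists g => //.
  exact: cycle_target (cycN g gN) (fP g i gN ig).
have f_inj : injective f.
  move=> i i'; have [iN|iN] := boolP (i \in packing_vertices N); last first.
    rewrite (f_out i iN) => def_i.
    have [i'N|/f_out <- //] := boolP (i' \in packing_vertices N).
    by rewrite def_i f_in in iN.
  have [i'N|i'N] := boolP (i' \in packing_vertices N); last first.
    by rewrite (f_out i' i'N) => def_i; rewrite -def_i f_in in i'N.
  case/bigcupP: iN => g gN ig; case/bigcupP: i'N => h hN ih eq_f.
  have gif := fP g i gN ig; have hif := fP h i' hN ih; rewrite -eq_f in hif.
  have gh : g = h.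
    apply: (packing_eq packN gN hN (i := f i)).
      by apply: cycle_target gif; apply: cycN.
    by apply: cycle_target hif; apply: cycN.
  by rewrite -gh in hif; apply: cycle_injective (cycN g gN) gif hif.
have fE g i : g \in N -> i \in cycle_vertices g ->
    g = perm_arcs (perm f_inj) (porbit (perm f_inj) i).
  move=> gN; apply: cycle_porbit (cycN g gN) _ => j.
  by rewrite permE; apply: fP.
exists (perm f_inj).
  by apply/subsetP => i; rewrite inE permE; apply: contraR => /f_out ->.
apply/setP => g; apply/imsetP/idP => [[_ /imsetP[i /bigcupP[h hN ih] ->] ->]|gN].
  by rewrite -(fE h).
have [i ig] := cycle_vertices_neq0 (cycN g gN).
exists (porbit (perm f_inj) i); last exact: fE.
by apply: imset_f; apply/bigcupP; exists g.
Qed.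

Lemma mem_porbit_imset S p i O : perm_on S p -> O \in porbit p @: S ->
  (i \in S) && (porbit p i == O) = (i \in O).
Proof.
move=> pS /imsetP[j jS ->]; rewrite eq_porbit_mem andb_idl //.
exact/subsetP/porbit_sub.
Qed.

(** The remaining orbits are the singletons outside [S]. *)
Lemma perm_cycles_card S p : perm_on S p ->
  #|porbits p| = (#|perm_cycles S p| + #|~: S|)%N.
Proof.
move=> pS; rewrite (card_imset _ (@perm_arcs_inj p)).
have fixC i : i \in ~: S -> porbit p i = [set i].
  rewrite inE => iS; apply/setP => j; rewrite inE; apply/porbitP/eqP => [[m ->]|->].
    by rewrite permX; elim: m => //= m ->; rewrite (out_perm pS).
  by exists 0%N; rewrite expg0 perm1.
have -> : porbits p = porbit p @: S :|: porbit p @: ~: S.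
  rewrite -imsetU setUCr; apply/setP => O.
  by apply/imsetP/imsetP => -[i _ ->]; exists i; rewrite ?inE.
rewrite cardsU -[RHS]subn0; congr (_ + _ - _)%N.
  by apply: card_in_imset => i j iS jS; rewrite !fixC // => /set1_inj.
apply/eqP; rewrite cards_eq0 -subset0; apply/subsetP => O.
rewrite inE => /andP[/imsetP[i iS ->] /imsetP[j jS]] eq_ij.
have : i \in porbit p j by rewrite -eq_ij porbit_id.
by rewrite fixC // inE => /eqP eq_i; rewrite eq_i in iS; rewrite inE iS in jS.
Qed.

Lemma perm_cycles_length S p : perm_on S p ->
  (\sum_(g in perm_cycles S p) #|g|)%N = #|S|.
Proof.
move=> pS; rewrite big_imset /=; last by move=> O O' _ _; apply: perm_arcs_inj.
rewrite -sum1_card (partition_big_imset (porbit p)) /=; apply: eq_bigr => O OS.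
rewrite card_imset => [|i j [] //]; rewrite -sum1_card; apply: eq_bigl => i.
by rewrite mem_porbit_imset.
Qed.

Variable (R : comNzRingType).
Implicit Type A : 'M[R]_n.

Definition packing_weight A N : R :=
  (-1) ^+ #|N| * \prod_(g in N) \prod_(a in g) A a.1 a.2.

(** The sign of a permutation is the parity of [n] plus its number of orbits, so
the signs of the entries of [- A] turn it into one sign per cycle. *)
Lemma perm_cycles_weight A S p : perm_on S p ->
  packing_weight A (perm_cycles S p) = (-1) ^+ p * \prod_(i in S) - A i (p i).
Proof.
move=> pS; rewrite prodrN mulrA /packing_weight; congr (_ * _).
  have sq m : (-1) ^+ m * (-1) ^+ m = 1 :> R.
    by rewrite -exprD addnn -signr_odd odd_double.
  rewrite /odd_perm signr_addb !signr_odd (perm_cycles_card pS) -(cardsC S) !exprD.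
  set a := (-1) ^+ #|S|; set b := (-1) ^+ #|~: S|; set k := (-1) ^+ #|_|.
  have -> : a * b * (k * b) * a = k * ((a * a) * (b * b)) by ring.
  by rewrite !sq !mulr1.
rewrite big_imset /=; last by move=> O O' _ _; apply: perm_arcs_inj.
rewrite (partition_big_imset (porbit p)) /=; apply: eq_bigr => O OS.
rewrite big_imset /= => [|i j _ _ [] //]; apply: eq_bigl => i.
by rewrite mem_porbit_imset.
Qed.

(** In the Leibniz expansion, a permutation that moves a vertex outside [S] meets
a zero of an identity row; the others amount to packings of cycles covering [S],
where a fixed point in [S] counts as a loop. *)
Lemma minorN_packings A S :
  minorN A S =
  \sum_(N | cycle_packing N && (packing_vertices N == S)) packing_weight A N.
Proof.
transitivity (\sum_(p | perm_on S p) packing_weight A (perm_cycles S p)).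
  rewrite [RHS]big_mkcond; apply: eq_bigr => p _; case: ifPn => [pS|].
    rewrite perm_cycles_weight //; congr (_ * _); rewrite [RHS]big_mkcond.
    apply: eq_bigr => i _; rewrite mxE; case: ifPn => // iS.
    by rewrite (out_perm pS) // eqxx.
  case/subsetPn=> i; rewrite inE => pi iS.
  rewrite (bigD1 i) //= mxE (negPf iS) eq_sym (negPf pi).
  by rewrite mul0r mulr0.
rewrite -(big_imset (packing_weight A) (@perm_cycles_inj S)) /=.
apply: eq_bigl => N; apply/imsetP/andP => [[p pS ->]|[packN /eqP <-]].
  by rewrite perm_cycles_packing perm_cycles_vertices.
by have [p pN defN] := perm_cycles_surj packN; exists p.
Qed.

End CyclePackings.

(** * Trivial heaps as colored packings *)

Section ColoredHeaps.
Variables (C : numClosedFieldType) (n c : nat) (A : 'I_c -> 'M[C]_n).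
Local Notation arcs := {set 'I_n * 'I_n}.
Implicit Types (N : {ffun 'I_c -> {set arcs}}) (M : {set arcs * 'I_c}).

Definition colored_union N : {set arcs * 'I_c} := [set x | x.1 \in N x.2].

Lemma colored_union_bij : bijective colored_union.
Proof.
exists (fun M => [ffun j => [set g | (g, j) \in M]]) => [N|M].
  by apply/ffunP => j; apply/setP => g; rewrite ffunE !inE.
by apply/setP => -[g j]; rewrite inE ffunE inE.
Qed.

Lemma big_colored_union (T : Type) (idx : T) (op : Monoid.com_law idx)
    N (E : arcs * 'I_c -> T) :
  \big[op/idx]_(x in colored_union N) E x =
  \big[op/idx]_j \big[op/idx]_(g in N j) E (g, j).
Proof.
rewrite pair_big_dep /= (reindex (fun p : 'I_c * arcs => (p.2, p.1))) /=.
  by apply: eq_big => -[j g] //; rewrite inE.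
by exists (fun x => (x.2, x.1)) => -[].
Qed.

Definition vertex_families N : {ffun 'I_c -> {set 'I_n}} :=
  [ffun j => packing_vertices (N j)].

Definition disjoint_packings N : bool :=
  [forall j, cycle_packing (N j)] &&
  [forall k, colors_at (vertex_families N) k <= 1]%N.

(** Vertex-disjointness of a heap splits into disjointness within each color and
the bound of one color per vertex. *)
Lemma trivial_heap_colored_union N :
  trivial_heap A (colored_union N) =
  disjoint_packings N && [forall x in colored_union N, cycle_weight A x != 0].
Proof.
apply/andP/andP => [[/forall_inP cycM /forall_inP disM]|]; last first.
  case=> /andP[/forallP packN /forallP m1] /forall_inP wM.
  split; apply/forall_inP => -[g j] gM.
    rewrite wM // andbT; move: gM; rewrite inE /=.
    by case/andP: (packN j) => /forall_inP cycN _ /cycN.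
  apply/forall_inP => -[h j'] hM; apply/implyP.
  apply: contraR => /pred0Pn[k /andP[/= kg kh]].
  rewrite !inE /= in gM hM.
  have eq_j : j = j'.
    have /card_le1_eqP := m1 k; apply; rewrite !inE !ffunE; apply/bigcupP.
      by exists h.
    by exists g.
  by rewrite -eq_j in hM *; rewrite (packing_eq (packN j) gM hM kg kh).
have in_M j g : g \in N j -> (g, j) \in colored_union N by rewrite inE.
have same g h j j' k : g \in N j -> h \in N j' ->
    k \in cycle_vertices g -> k \in cycle_vertices h -> (g, j) = (h, j').
  move=> gN hN kg kh; apply/eqP; apply: contraTT isT => gh.
  have /forall_inP/(_ _ (in_M _ _ hN))/implyP/(_ gh) := disM _ (in_M _ _ gN).
  by move/disjointFr/(_ kg); rewrite kh.
split; last by apply/forall_inP => x /cycM /andP[].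
apply/andP; split.
  apply/forallP => j; apply/andP; split; apply/forall_inP => g gN.
    by have /andP[] := cycM _ (in_M _ _ gN).
  apply/forall_inP => h hN; apply/implyP.
  apply: contraR => /pred0Pn[k /andP[/= kg kh]].
  by have [->] := same _ _ _ _ _ gN hN kg kh.
apply/forallP => k; apply/card_le1_eqP => j j'; rewrite !inE !ffunE.
move=> /bigcupP[g gN kg] /bigcupP[h hN kh].
by have [_ ->] := same _ _ _ _ _ gN hN kg kh.
Qed.

Lemma signed_weight_colored_union N :
  (-1) ^+ #|colored_union N| * heap_weight A (colored_union N) =
  \prod_j packing_weight (A j) (N j).
Proof.
rewrite /heap_weight -sum1_card !big_colored_union expr_sum -big_split /=.
by apply: eq_bigr => j _; rewrite sum1_card.
Qed.

Lemma packing_length (N : {set arcs}) : cycle_packing N ->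
  (\sum_(g in N) #|g|)%N = #|packing_vertices N|.
Proof.
by case/perm_cycles_surj => p pN defN; rewrite -[in LHS]defN perm_cycles_length.
Qed.

Lemma heap_length_colored_union N : disjoint_packings N ->
  heap_length (colored_union N) = (\sum_k colors_at (vertex_families N) k)%N.
Proof.
case/andP=> /forallP packN _; rewrite /heap_length big_colored_union.
under [RHS]eq_bigr do rewrite /colors_at -sum1_card.
rewrite [RHS](exchange_big_dep predT) //=; apply: eq_bigr => j _.
transitivity #|packing_vertices (N j)|; first exact: packing_length.
by rewrite -sum1_card; apply: eq_bigl => k; rewrite !inE ffunE.
Qed.

(** Colored cycles sort by color, the cycles of one color sum up to a minor of
[- A j], and the exponents [1] say that no vertex gets two colors. Heaps with a
cycle of weight zero may be added, as their terms vanish. *)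
Lemma additive_char_polyE (z : C) :
  (additive_char_poly A).[z] =
  truncation (fun S : {ffun 'I_c -> {set 'I_n}} => \prod_j minorN (A j) (S j))
    (@colors_at n c) (fun=> 1%N) (fun=> z).
Proof.
have length_le N : disjoint_packings N -> (heap_length (colored_union N) <= n)%N.
  move=> disN; rewrite heap_length_colored_union //.
  rewrite -[n in (_ <= n)%N]card_ord -sum1_card.
  by apply: leq_sum => k _; case/andP: disN => _ /forallP/(_ k).
transitivity (\sum_(N | disjoint_packings N)
    (\prod_j packing_weight (A j) (N j)) *
      z ^+ (n - heap_length (colored_union N))).
  rewrite horner_sum.
  under eq_bigr do rewrite hornerZ hornerXn mulr_suml.
  rewrite (exchange_big_dep (trivial_heap A)) /= => [|k M _ /andP[] //].
  rewrite (reindex colored_union) /=; last exact: onW_bij colored_union_bij.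
  rewrite [LHS]big_mkcond [RHS]big_mkcond /=; apply: eq_bigr => N _.
  rewrite trivial_heap_colored_union; case: ifPn => [/andP[disN wM]|].
    rewrite disN signed_weight_colored_union.
    have leN := length_le N disN.
    rewrite (big_pred1 (Ordinal (leN : (_ < n.+1)%N))) // => k.
    by rewrite wM /= eq_sym.
  rewrite negb_and; case: ifP => //= disN; rewrite negb_forall => /existsP[x].
  rewrite negb_imply negbK => /andP[xM /eqP wx0].
  rewrite -signed_weight_colored_union /heap_weight (bigD1 x) //= wx0.
  by rewrite mul0r mulr0 mul0r.
rewrite (partition_big vertex_families
  (fun S => [forall k, colors_at S k <= 1]%N)) /= => [|N /andP[] //].
apply: eq_bigr => S /forallP m1.
under [in RHS]eq_bigr do rewrite minorN_packings.
rewrite bigA_distr_big_dep mulr_suml; apply: eq_big => [N|N /andP[disN /eqP defS]].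
  apply/andP/familyP => [[/andP[/forallP packN _] /eqP <-] j|famN].
    by rewrite unfold_in packN ffunE eqxx.
  have defS : vertex_families N = S.
    apply/ffunP => j; rewrite ffunE; have := famN j.
    by rewrite unfold_in => /andP[_ /eqP].
  split; last by rewrite defS.
  apply/andP; split; last by apply/forallP => k; rewrite defS.
  by apply/forallP => j; have := famN j; rewrite unfold_in => /andP[].
congr (_ * _); rewrite -expr_sum heap_length_colored_union // defS; congr (_ ^+ _).
by rewrite sumnB => [|k _]; [rewrite sum1_card card_ord | exact: m1].
Qed.

(** * Real-rootedness *)

Lemma additive_char_poly_real_rooted : (forall j, A j \is hermsymmx) ->
  real_rooted (additive_char_poly A).
Proof.
move=> hA z; rewrite /root additive_char_polyE; apply: contraTT => z_nonreal.
have Im_real : 'Im z \is Num.real by exact: Creal_Im.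
(* The half-plane with [s = 'Im z] is the one that contains [z]. *)
apply: (stable_truncate_all Im_real (ltn0Sn c)) => [T|_].
  exact: stable_minors.
rewrite /half_plane -expr2 real_exprn_even_gt0 //=.
by apply: contra z_nonreal => /eqP/Creal_ImP.
Qed.
End ColoredHeaps.

Theorem theorem4p25 (R : realType) (n c : nat) (A : 'I_c -> 'M[R[i]]_n)
    (hA : forall j : 'I_c, A j \is hermsymmx) :
  real_rooted (additive_char_poly A).
Proof. exact: additive_char_poly_real_rooted. Qed.
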